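(* Let $M,N,R\ge 1$ be integers, let $\beta\in[1,2]$, let $V=(v_{mn})\in\mathbb{R}_+^{M\times N}$, and let $W\in\mathbb{R}^{R\times M}$ and $H\in\mathbb{R}^{R\times N}$ be fixed matrices with positive entries, with columns $w_1,\dots,w_M\in\mathbb{R}^R$ and $h_1,\dots,h_N\in\mathbb{R}^R$ respectively. Then the optimization problem $$\min_{\Lambda\in\mathbb{R}_+^{N\times N}\ \text{diagonal}} D_\beta\left(V,\,W^\top H\Lambda\right)$$ has a closed-form solution $\Lambda^*$, whose diagonal entries are, for all $1\le n\le N$, $$\lambda^*_{nn}=\frac{\sum_{m=1}^M v_{mn}\,(w_m^\top h_n)^{\beta-1}}{\sum_{m=1}^M (w_m^\top h_n)^{\beta}}.$$
   Context: For matrices $X=(x_{mn}),Y=(y_{mn})\in\mathbb{R}_+^{M\times N}$, $D_\beta(X,Y)=\sum_{m=1}^M\sum_{n=1}^N d_\beta(x_{mn},y_{mn})$, where the $\beta$-divergence is $d_\beta(x,y)=x\log\frac{x}{y}-x+y$ if $\beta=1$, and $d_\beta(x,y)=\frac{1}{\beta(\beta-1)}\left(x^\beta+(\beta-1)y^\beta-\beta x y^{\beta-1}\right)$ if $\beta\in(1,2]$. For $\beta=1$ the usual conventions are used: $d_1(0,y)=y$ for all $y\ge 0$, and $d_1(x,0)=+\infty$ for $x>0$. *)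

(* Defs.v *)
From mathcomp Require Import all_boot all_order all_algebra.
From mathcomp Require Import all_classical all_reals all_analysis.
Set Implicit Arguments.
Unset Strict Implicit.
Unset Printing Implicit Defensive.
Import Order.TTheory GRing.Theory Num.Theory.
Local Open Scope classical_set_scope.
Local Open Scope ring_scope.

(* The divergence takes extended real values because of d_1(x, 0) = +oo for
   x > 0.  The definition is meant for beta in [1, 2] and x, y >= 0.  The case
   x = 0 is tested first, so that d_1(0, 0) = 0. *)
Definition beta_div (K : realType) (beta x y : K) : \bar K :=
  if beta == 1 then
    if x == 0 then y%:E
    else if y == 0 then +oo%E
    else (x * ln (x / y) - x + y)%:E
  else ((beta * (beta - 1))^-1 *
        (x `^ beta + (beta - 1) * y `^ beta - beta * x * y `^ (beta - 1)))%:E.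

Definition beta_div_mx (K : realType) (M N : nat) (beta : K)
    (X Y : 'M[K]_(M, N)) : \bar K :=
  (\sum_(m < M) \sum_(n < N) beta_div beta (X m n) (Y m n))%E.

Definition nneg_diag_mx (K : realType) (N : nat) : set 'M[K]_N :=
  [set L | is_diag_mx L /\ L \is a mxOver Num.nneg].

Definition is_minimizer (K : realType) (T : Type) (S : set T)
    (f : T -> \bar K) (x : T) : Prop :=
  S x /\ forall y, S y -> (f x <= f y)%E.

(* Main.v *)
(** The problem splits over the columns.  For one column put a_m = w_m^T h_n,
    p = sum_m v_m a_m^(beta-1), q = sum_m a_m^beta and mu = p / q.  There are
    coefficients A and B depending only on beta, mu and l such that
      d(v, a mu) + A a^beta - B v a^(beta-1) <= d(v, a l)
    for every entry, so the objective grows from mu to l by at least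
    A q - B p = q (A - B mu).  The scalar inequality B mu <= A is Young's
    inequality with exponents beta and beta / (beta - 1) when beta > 1, and
    ln x <= x - 1 when beta = 1. *)
Require Import Defs.
From mathcomp Require Import all_boot all_order all_algebra.
From mathcomp Require Import all_classical all_reals all_analysis.
From mathcomp Require Import ring lra.
Set Implicit Arguments.
Unset Strict Implicit.
Unset Printing Implicit Defensive.
Import Order.TTheory GRing.Theory Num.Theory.
Local Open Scope classical_set_scope.
Local Open Scope ring_scope.

(** Young's inequality for [x] and the power of [y] of exponent [beta - 1], multiplied by [beta]. It
    amounts to [0 <= beta_div beta x y] for [beta > 1]. *)
Lemma powR_young (K : realType) (beta x y : K) :
    1 < beta -> 0 <= x -> 0 <= y ->
  beta * x * y `^ (beta - 1) <= x `^ beta + (beta - 1) * y `^ beta.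
Proof.
move=> b1 x0 y0.
have b0 : 0 < beta by rewrite (lt_trans _ b1).
have c0 : 0 < beta - 1 by rewrite subr_gt0.
have q0 : 0 < beta / (beta - 1) by rewrite divr_gt0.
have bN0 : beta != 0 by rewrite gt_eqF.
have cN0 : beta - 1 != 0 by rewrite gt_eqF.
have conj : beta^-1 + (beta / (beta - 1))^-1 = 1.
  by rewrite invf_div; field.
have := conjugate_powR x0 (powR_ge0 y (beta - 1)) b0 q0 conj.
rewrite -powRrM.
have -> : (beta - 1) * (beta / (beta - 1)) = beta by field.
rewrite -(ler_pM2l b0) mulrA => /le_trans; apply.
by rewrite le_eqVlt; apply/predU1P; left; field; rewrite cN0 bN0.
Qed.

(* weight_coef and data_coef are the coefficients A and B. *)
Definition weight_coef (K : realType) (beta mu l : K) : K :=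
  if beta == 1 then l - mu
  else beta^-1 * (l `^ beta - mu `^ beta).

(* At beta = 1, l = 0 the logarithm has the junk value ln 0 = 0.  There B only
   meets entries with v = 0 or d(v, a l) = +oo, so any B <= -1 would do. *)
Definition data_coef (K : realType) (beta mu l : K) : K :=
  if beta == 1 then if l == 0 then -1 else ln (l / mu)
  else (beta - 1)^-1 * (l `^ (beta - 1) - mu `^ (beta - 1)).

(** The gap between the two sides is the divergence d(mu, l), except at [beta = 1], [l = 0 < mu],
    where the value -1 of [data_coef] makes the gap zero. *)
Lemma data_coef_le (K : realType) (beta mu l : K) :
    1 <= beta -> 0 <= mu -> 0 <= l ->
  data_coef beta mu l * mu <= weight_coef beta mu l.
Proof.
move=> b1 mu0 l0; rewrite /data_coef /weight_coef.
case: eqVneq => [_|bN1]; last first.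
  have b1' : 1 < beta by rewrite lt_neqAle eq_sym bN1.
  have b0 : 0 < beta by rewrite (lt_trans _ b1').
  have c0 : 0 < beta - 1 by rewrite subr_gt0.
  have bN0 : beta != 0 by rewrite gt_eqF.
  have cN0 : beta - 1 != 0 by rewrite gt_eqF.
  have muE : mu `^ beta = mu * mu `^ (beta - 1) by rewrite mulr_powRB1.
  rewrite -subr_ge0.
  set X := (X in 0 <= X).
  suff -> : X = (beta * (beta - 1))^-1 *
     (mu `^ beta + (beta - 1) * l `^ beta - beta * mu * l `^ (beta - 1)).
    rewrite mulr_ge0 ?invr_ge0 ?mulr_ge0 ?(ltW b0) ?(ltW c0)//.
    by rewrite subr_ge0 powR_young.
  by rewrite /X muE; field; rewrite cN0 bN0.
case: eqVneq => [->|lN0]; first by rewrite mulN1r sub0r.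
have [->|muN0] := eqVneq mu 0; first by rewrite mulr0 subr0.
have mu_gt0 : 0 < mu by rewrite lt_def muN0.
have l_gt0 : 0 < l by rewrite lt_def lN0.
have := @le_ln1Dx _ (l / mu - 1).
rewrite subrKC ltrBrDl subrr => /(_ (divr_gt0 l_gt0 mu_gt0)).
rewrite -(ler_pM2r mu_gt0) => /le_trans; apply.
by rewrite mulrBl mul1r divfK.
Qed.

(** Powers and logarithms split over the products a mu and a l, so this is an equality unless the
    right side is +oo. The last hypothesis keeps the left side finite at [beta = 1]. *)
Lemma beta_div_tangent (K : realType) (beta v a mu l : K) :
    1 <= beta -> 0 <= v -> 0 < a -> 0 <= mu -> 0 <= l ->
    (v != 0 -> mu != 0) ->
  (beta_div beta v (a * mu) +
     (weight_coef beta mu l * a `^ beta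
       - data_coef beta mu l * (v * a `^ (beta - 1)))%:E
   <= beta_div beta v (a * l))%E.
Proof.
move=> b1 v0 a0 mu0 l0 vmu; rewrite /beta_div /data_coef /weight_coef.
have [bE|bN1] := eqVneq beta 1.
  rewrite bE powRr1 ?(ltW a0)// subrr powRr0 mulr1.
  have [->|vN0] := eqVneq v 0.
    by rewrite mulr0 subr0 -EFinD lee_fin; nra.
  have muN0 := vmu vN0.
  have aN0 : a != 0 by rewrite gt_eqF.
  rewrite !mulf_eq0 (negPf aN0) (negPf muN0) /=.
  have [_|lN0] := eqVneq l 0; first by rewrite leey.
  have mu_gt0 : 0 < mu by rewrite lt_def muN0.
  have l_gt0 : 0 < l by rewrite lt_def lN0.
  have v_gt0 : 0 < v by rewrite lt_def vN0.
  rewrite -EFinD lee_fin !ln_div ?posrE ?mulr_gt0// !lnM ?posrE//.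
  by rewrite le_eqVlt; apply/predU1P; left; ring.
have b1' : 1 < beta by rewrite lt_neqAle eq_sym bN1.
have b0 : 0 < beta by rewrite (lt_trans _ b1').
have bN0 : beta != 0 by rewrite gt_eqF.
have cN0 : beta - 1 != 0 by rewrite subr_eq0.
rewrite -EFinD lee_fin !powRM ?(ltW a0)//.
by rewrite le_eqVlt; apply/predU1P; left; field; rewrite cN0 bN0.
Qed.

Lemma mulmx_pos (K : numDomainType) (m n p : nat)
    (A : 'M[K]_(m, n)) (B : 'M[K]_(n, p)) :
    (0 < n)%N -> A \is a mxOver Num.pos -> B \is a mxOver Num.pos ->
  A *m B \is a mxOver Num.pos.
Proof.
move=> n0 /mxOverP A0 /mxOverP B0; apply/mxOverP => i j.
have AB0 k : 0 < A i k * B k j.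
  by rewrite mulr_gt0 // -posrE.
rewrite posrE mxE (bigD1 (Ordinal n0)) //= ltr_wpDr // sumr_ge0 // => k _.
exact: ltW.
Qed.

Theorem proposition8 (K : realType) (M N R : nat)
    (hM : (1 <= M)%N) (hN : (1 <= N)%N) (hR : (1 <= R)%N)
    (beta : K) (hbeta : 1 <= beta <= 2)
    (V : 'M[K]_(M, N)) (hV : V \is a mxOver Num.nneg)
    (W : 'M[K]_(R, M)) (hW : W \is a mxOver Num.pos)
    (H : 'M[K]_(R, N)) (hH : H \is a mxOver Num.pos) :
  exists L : 'M[K]_N,
    is_minimizer (@nneg_diag_mx K N)
      (fun L' : 'M[K]_N => beta_div_mx beta V (W^T *m H *m L')) L /\
    forall n : 'I_N,
      L n n = (\sum_(m < M)
                 V m n * (((col m W)^T *m col n H) 0 0) `^ (beta - 1)) /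
              (\sum_(m < M) (((col m W)^T *m col n H) 0 0) `^ beta).
Proof.
case/andP: hbeta => b1 _.
pose a m n := ((col m W)^T *m col n H) 0 0.
pose p n := \sum_(m < M) V m n * a m n `^ (beta - 1).
pose q n := \sum_(m < M) a m n `^ beta.
have v_ge0 m n : 0 <= V m n by move/mxOverP: hV => /(_ m n).
have aE m n : (W^T *m H) m n = a m n.
  by rewrite /a !mxE; apply: eq_bigr => i _; rewrite !mxE.
have a_gt0 m n : 0 < a m n.
  rewrite -aE; move: m n; apply/mxOverP; apply: mulmx_pos => //.
  by apply/mxOverP => i j; rewrite mxE; move/mxOverP: hW.
have pw_gt0 m n : 0 < V m n -> 0 < V m n * a m n `^ (beta - 1).
  by move=> v0; rewrite mulr_gt0 // powR_gt0.
have pw_ge0 m n : 0 <= V m n * a m n `^ (beta - 1).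
  by rewrite mulr_ge0 ?powR_ge0.
have q_gt0 n : 0 < q n.
  rewrite /q (bigD1 (Ordinal hM)) //= ltr_wpDr ?powR_gt0 //.
  by rewrite sumr_ge0 // => i _; apply: powR_ge0.
have p_ge0 n : 0 <= p n by apply: sumr_ge0.
have mu_ge0 n : 0 <= p n / q n by rewrite divr_ge0 // ltW.
have prodE (L : 'M[K]_N) m n :
    is_diag_mx L -> (W^T *m H *m L) m n = a m n * L n n.
  move=> /is_diag_mxP dL; rewrite mxE (bigD1 n) //= big1 ?addr0 ?aE //.
  by move=> i ni; rewrite dL ?mulr0.
pose L := diag_mx (\row_n (p n / q n)).
have LE n : L n n = p n / q n by rewrite !mxE eqxx.
have dL : is_diag_mx L by apply: diag_mx_is_diag.
exists L; split; last by [].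
split.
  split=> //; apply/mxOverP => i j; rewrite nnegrE !mxE.
  by case: eqP => _ //=; rewrite ?mulr1n ?mulr0n.
move=> L' [dL' nL']; rewrite /beta_div_mx.
have l_ge0 n : 0 <= L' n n by move/mxOverP: nL' => /(_ n n).
pose r m n := weight_coef beta (L n n) (L' n n) * a m n `^ beta
  - data_coef beta (L n n) (L' n n) * (V m n * a m n `^ (beta - 1)).
have r_ge0 : 0 <= \sum_(m < M) \sum_(n < N) r m n.
  (* Single terms [r m n] may be negative. Summed over a column they give A q - B p, and p = mu q
     reduces the claim to B mu <= A. *)
  rewrite exchange_big sumr_ge0 //= => n _.
  rewrite sumrB -!mulr_sumr -/(p n) -/(q n) subr_ge0.
  have -> : p n = L n n * q n by rewrite LE divfK // gt_eqF.
  rewrite mulrA ler_pM2r //.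
  by apply: data_coef_le; rewrite // LE.
apply: (@le_trans _ _ (\sum_(m < M) \sum_(n < N)
    (beta_div beta (V m n) ((W^T *m H *m L) m n) + (r m n)%:E))%E).
  under [leRHS]eq_bigr do rewrite big_split sumEFin.
  by rewrite big_split sumEFin leeDl.
apply: lee_sum => m _; apply: lee_sum => n _.
rewrite !prodE //; apply: beta_div_tangent => //; first by rewrite LE.
(* A nonzero entry of [V] in column [n] makes [p n] positive, hence mu is nonzero. *)
move=> vN0; rewrite LE mulf_neq0 ?invr_neq0 ?gt_eqF //.
rewrite /p (bigD1 m) //= ltr_wpDr ?sumr_ge0 //.
by apply: pw_gt0; rewrite lt_def vN0 v_ge0.
Qed.
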